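(* Let $X_{\mathbf 1} = \{0\} \cup \bigcup_{n=1}^{\infty}\left[\frac{1}{2^n}, \frac{1}{2^n}+\frac{1}{2^{n+1}}\right] \subset \mathbb{R}$, equipped with the Euclidean metric $d(x,y)=|x-y|$ (a compact metric space). Let $\mathcal M_{X_{\mathbf 1}}$ be the set of isometry classes of compact metric spaces $X$ such that $d_L(X, X_{\mathbf 1})<\infty$, where $d_L$ is the Lipschitz distance. Then the metric space $(\mathcal M_{X_{\mathbf 1}}, d_L)$ is not separable.
   Context: For compact metric spaces $(X,d_X)$ and $(Y,d_Y)$ and a Lipschitz map $f:X\to Y$, the dilation of $f$ is its smallest Lipschitz constant, $\mathrm{dil}(f)=\sup_{x,y\in X,\, x\neq y}\frac{d_Y(f(x),f(y))}{d_X(x,y)}$. For $\epsilon \ge 0$, a bi-Lipschitz homeomorphism $f:X\to Y$ is called an $\epsilon$-isometry if $|\log \mathrm{dil}(f)|+|\log \mathrm{dil}(f^{-1})|\le \epsilon$. The Lipschitz distance $d_L(X,Y)$ is the infimum of all $\epsilon\ge 0$ such that an $\epsilon$-isometry $f:X\to Y$ exists (with $d_L(X,Y)=\infty$ if there is none). It depends only on the isometry classes of $X$ and $Y$ and is a metric (possibly taking the value $\infty$) on the set of isometry classes of compact metric spaces. *)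

(* Defs.v *)
From HB Require Import structures.
From mathcomp Require Import all_boot all_order all_algebra.
From mathcomp Require Import all_classical all_reals all_analysis.
Set Implicit Arguments.
Unset Strict Implicit.
Unset Printing Implicit Defensive.
Import Order.TTheory GRing.Theory Num.Theory.
Import numFieldNormedType.Exports.
Local Open Scope classical_set_scope.
Local Open Scope ring_scope.

Record compactMetric (R : realType) := CompactMetric {
  cm_space :> metricType R;
  cm_compact : compact [set: cm_space] }.

Section lipschitz_distance.
Context {R : realType}.
Implicit Types X Y Z : metricType R.

Definition is_lipschitz X Y (f : X -> Y) :=
  exists k : R, forall x y, mdist (f x) (f y) <= k * mdist x y.

(* [sup] is only meaningful when [f] is Lipschitz.  If X has at most one point
   the set is empty, [dil f = 0] and [ln (dil f) = 0], so that any two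
   one-point spaces are at Lipschitz distance 0. *)
Definition dil X Y (f : X -> Y) : R :=
  sup [set mdist (f x.1) (f x.2) / mdist x.1 x.2 | x in [set x | x.1 != x.2]].

Definition eps_isometry X Y (e : R) (f : X -> Y) := exists g : Y -> X,
  [/\ cancel f g, cancel g f, is_lipschitz f, is_lipschitz g &
      `|ln (dil f)| + `|ln (dil g)| <= e].

Definition lip_dist X Y : \bar R :=
  ereal_inf [set e%:E | e in
    [set e : R | 0 <= e /\ exists f : X -> Y, eps_isometry e f]].

Definition isometric X Y := exists2 f : X -> Y,
  bijective f & forall x y, mdist (f x) (f y) = mdist x y.

(* Classes are plain predicates: the universe of [set] is too small for
   [set (compactMetric R)]. *)
Definition isom_class (X : compactMetric R) : compactMetric R -> Prop :=
  fun Y : compactMetric R => isometric X Y.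

(* The infimum is over a single value, by [lip_dist_classE]. *)
Definition lip_dist_class (C D : compactMetric R -> Prop) : \bar R :=
  ereal_inf [set r | exists X Y : compactMetric R, [/\ C X, D Y & r = lip_dist X Y]].

Lemma isometric_refl X : isometric X X.
Proof. by exists id => //; exists id. Qed.

Lemma isometric_sym X Y : isometric X Y -> isometric Y X.
Proof.
move=> [f [g fK gK] fi]; exists g; first by exists f.
by move=> x y; rewrite -fi !gK.
Qed.

Lemma isometric_trans X Y Z : isometric X Y -> isometric Y Z -> isometric X Z.
Proof.
move=> [f bf fi] [g bg gi]; exists (g \o f); first exact: bij_comp.
by move=> x y /=; rewrite gi fi.
Qed.

Lemma dil_isomL X Y Z (f : X -> Y) (g : Y -> Z) :
  (forall x y, mdist (g x) (g y) = mdist x y) -> dil (g \o f) = dil f.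
Proof.
move=> gi; rewrite /dil; congr sup.
by apply: eq_imagel => -[x y] _ /=; rewrite gi.
Qed.

Lemma dil_isomR X Y Z (f : X -> Y) (g : Y -> Z) : bijective f ->
  (forall x y, mdist (f x) (f y) = mdist x y) -> dil (g \o f) = dil g.
Proof.
move=> [h fK hK] fi; rewrite /dil; congr sup; apply/seteqP; split.
  move=> _ [[x y] /= xy <-]; exists (f x, f y) => /=; last by rewrite fi.
  by rewrite (can_eq fK).
move=> _ [[x y] /= xy <-]; exists (h x, h y) => /=.
  by rewrite (can_eq hK).
by rewrite !hK -fi !hK.
Qed.

Lemma lip_dist_isom_le X X' Y Y' : isometric X X' -> isometric Y Y' ->
  (lip_dist X Y <= lip_dist X' Y')%E.
Proof.
move=> [u [u' uK u'K] ui] [v [v' vK v'K] vi].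
have u'i x y : mdist (u' x) (u' y) = mdist x y by rewrite -ui !u'K.
have v'i x y : mdist (v' x) (v' y) = mdist x y by rewrite -vi !v'K.
apply: ereal_inf_le_tmp => _ [e [e0 [f [g [fK gK [k fk] [l gl] le]]]] <-].
exists e => //; split=> //; exists (v' \o (f \o u)), (u' \o (g \o v)); split.
- by move=> x /=; rewrite v'K fK uK.
- by move=> x /=; rewrite u'K gK vK.
- by exists k => x y /=; rewrite v'i -[mdist x y]ui.
- by exists l => x y /=; rewrite u'i -[mdist x y]vi.
- rewrite (dil_isomL _ v'i) (dil_isomL _ u'i).
  by rewrite dil_isomR//; [rewrite dil_isomR//; exists v'|exists u'].
Qed.

Lemma lip_dist_classE (X Y : compactMetric R) :
  lip_dist_class (isom_class X) (isom_class Y) = lip_dist X Y.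
Proof.
apply/le_anti/andP; split.
  apply: ereal_inf_lbound; exists X, Y.
  by split => //; exact: isometric_refl.
apply: le_ereal_inf_tmp => _ [X' [Y' [XX' YY' ->]]].
exact: lip_dist_isom_le.
Qed.

End lipschitz_distance.

(* Some countable [D] included in [A] is dense in [A] for the distance [d].
   Countability is spelled out as an injection into nat because [T] is allowed
   to be larger than the universe of [set] and [countable]. *)
Definition separable_for (R : realType) (T : Type) (d : T -> T -> \bar R)
    (A : T -> Prop) :=
  exists D : T -> Prop,
    [/\ exists c : T -> nat, forall x y, D x -> D y -> c x = c y -> x = y,
        forall x, D x -> A x &
        forall x, A x -> forall e : R, 0 < e ->
          exists2 y, D y & (d x y < e%:E)%E].

Section subspace_metric.
Context {R : realType} (A : set R).

Let sdist (x y : A) : R := `|\val x - \val y|.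

Let sdist_ge0 x y : 0 <= sdist x y. Proof. exact: normr_ge0. Qed.

Let sdist_pos x y : sdist x y = 0 -> x = y.
Proof. by move/normr0_eq0/subr0_eq/val_inj. Qed.

Let ballEsdist (x : A) d : ball x d = [set y | sdist x y < d].
Proof. by []. Qed.

HB.instance Definition _ := PseudoMetric_isMetric.Build R A
  sdist_ge0 sdist_pos ballEsdist.

Lemma subspace_mdistE (x y : A) : mdist x y = `|\val x - \val y|.
Proof. by []. Qed.

End subspace_metric.

Definition X1_set (R : realType) : set R :=
  [set 0] `|` \bigcup_(n in [set n : nat | (1 <= n)%N])
    `[1 / 2 ^+ n, 1 / 2 ^+ n + 1 / 2 ^+ n.+1]%classic.

Arguments X1_set : clear implicits.

Lemma X1_setE (R : realType) : X1_set R = \bigcap_(N in [set: nat])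
  (`[0, 1 / 2 ^+ N]%classic `|` \bigcup_(n in `I_N)
    `[1 / 2 ^+ n.+1, 1 / 2 ^+ n.+1 + 1 / 2 ^+ n.+2]%classic).
Proof.
have p2 n : 0 < 1 / 2 ^+ n :> R by rewrite divr_gt0// exprn_gt0.
have le2 m n : (m <= n)%N -> 1 / 2 ^+ n <= 1 / 2 ^+ m :> R.
  move=> mn; rewrite !div1r lef_pV2 ?posrE ?exprn_gt0//.
  by rewrite ler_eXn2l// ltr1n.
apply/seteqP; split=> [x [->|[[//|n] _ xn]] N _|x xN].
- by left; rewrite /= in_itv/= lexx (ltW (p2 N)).
- have [nN|Nn] := ltnP n N; first by right; exists n.
  left; move: xn; rewrite /= !in_itv/= => /andP[x1 x2].
  rewrite (le_trans (ltW (p2 _)) x1)/= (le_trans x2)//.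
  rewrite (le_trans _ (le2 _ _ Nn))//.
  apply: (@le_trans _ _ (1 / 2 ^+ n.+1 + 1 / 2 ^+ n.+1)).
    by rewrite lerD2l le2.
  by rewrite exprSr !div1r invfM -splitr.
- have [x0|x0] := leP x 0.
    left; have [] := xN 0%N I; last by case.
    by rewrite /= in_itv/= => /andP[x0' _]; apply/le_anti; rewrite x0.
  have [N Nx] : exists N, 1 / 2 ^+ N < x.
    have [N _ Nx] := near_infty_natSinv_lt (PosNum x0).
    exists N.+1; apply: le_lt_trans (Nx N (leqnn N)).
    rewrite div1r lef_pV2 ?posrE ?exprn_gt0// -natrX ler_nat.
    exact/ltnW/ltn_expl.
  have [|[n _ xn]] := xN N I; first by rewrite /= in_itv/= => /andP[_]; rewrite leNgt Nx.
  by right; exists n.+1.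
Qed.

Lemma X1_set_compact (R : realType) : compact (X1_set R).
Proof.
apply: (@subclosed_compact R (X1_set R) (`[0, 1]%classic : set R)).
- rewrite X1_setE; apply: closed_bigI => N _; apply: closedU.
    exact: itv_closed.
  by apply: closed_bigcup => // n _; exact: itv_closed.
- exact: segment_compact.
- rewrite X1_setE => x /(_ 0%N I)[|[n //]].
  by rewrite expr0 divr1.
Qed.

Lemma subspace_compact (R : realType) (A : set R) :
  compact A -> compact [set: A].
Proof.
move=> cA F PF _.
have [|x [Ax Fx]] := cA (fmap \val F) (fmap_proper_filter _ PF).
  apply: (@filterS _ F _ setT); last exact: filterT.
  by move=> y _; exact: set_valP.
exists (exist _ x (mem_set Ax) : A); split=> // U V FU /nbhs_ballP[e /= e0 eV].
have [|_ [[y Uy <-] xy]] := Fx (\val @` U) (ball x e) _ (nbhsx_ballx x e e0).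
  by apply: (@filterS _ F _ U) => // y Uy; exists y.
by exists y; split => //; exact: eV.
Qed.

Definition X1_space (R : realType) : compactMetric R :=
  CompactMetric (subspace_compact (@X1_set_compact R)).

Definition M_X1 (R : realType) : (compactMetric R -> Prop) -> Prop :=
  fun C => exists2 X : compactMetric R,
    C = isom_class X & (lip_dist X (X1_space R) < +oo)%E.

(* Main.v *)
(* For t : nat -> bool, let X_t be obtained from X_1 by halving the piece at
   2^-n whenever t n is false. Affine rescaling of the pieces makes all the X_t
   bi-Lipschitz to each other. A bi-Lipschitz bijection X_t -> X_t' with
   constants close to 1 fixes 0, hence almost preserves the distance to 0, hence
   sends the n-th piece to the n-th piece, hence forces t n = t' n. So the
   uncountably many X_t are uniformly separated; in the diagonal argument, a
   code of a dense point close to X_t determines t. *)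
Require Import Defs.
From mathcomp Require Import all_boot all_order all_algebra.
From mathcomp Require Import all_classical all_reals all_analysis.
From mathcomp Require Import ring lra.
Set Implicit Arguments.
Unset Strict Implicit.
Unset Printing Implicit Defensive.
Import Order.TTheory GRing.Theory Num.Theory.
Import numFieldNormedType.Exports.
Local Open Scope classical_set_scope.
Local Open Scope ring_scope.

(** * From the Lipschitz distance to bi-Lipschitz bijections and back *)

Section lipschitz_maps.
Context {R : realType}.
Implicit Types X Y Z : metricType R.

Definition lipschitz_with X Y (k : R) (f : X -> Y) :=
  forall x y, mdist (f x) (f y) <= k * mdist x y.

Definition bilipschitz X Y (k : R) := exists (f : X -> Y) (g : Y -> X),
  [/\ cancel f g, cancel g f, lipschitz_with k f & lipschitz_with k g].

Lemma bilipschitz_sym X Y k : bilipschitz X Y k -> bilipschitz Y X k.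
Proof. by move=> [f [g [fK gK fk gk]]]; exists g, f; split. Qed.

Lemma bilipschitz_trans X Y Z k l : 0 <= k -> 0 <= l ->
  bilipschitz X Y k -> bilipschitz Y Z l -> bilipschitz X Z (k * l).
Proof.
move=> k0 l0 [f [f' [fK f'K fk f'k]]] [g [g' [gK g'K gl g'l]]].
exists (g \o f), (f' \o g'); split.
- exact: can_comp.
- exact: can_comp.
- move=> x y /=; rewrite [k * l]mulrC -mulrA.
  by apply: (le_trans (gl _ _)); rewrite ler_wpM2l.
- move=> x y /=; rewrite -mulrA.
  by apply: (le_trans (f'k _ _)); rewrite ler_wpM2l.
Qed.

Lemma bilipschitz_lip_dist_fin X Y k :
  bilipschitz X Y k -> (lip_dist X Y < +oo)%E.
Proof.
move=> [f [g [fK gK fk gk]]].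
apply: (@le_lt_trans _ _ (`|ln (dil f)| + `|ln (dil g)|)%:E); last exact: ltry.
apply: ereal_inf_lbound; exists (`|ln (dil f)| + `|ln (dil g)|) => //=.
split; first by rewrite addr_ge0.
by exists f, g; split => //; exists k.
Qed.

Lemma lipschitz_dil X Y (f : X -> Y) :
  is_lipschitz f -> lipschitz_with (dil f) f.
Proof.
move=> [k fk] x y; have [->|xy] := eqVneq x y.
  by rewrite !mdistxx mulr0.
have xy0 : 0 < mdist x y by rewrite mdist_gt0.
rewrite -ler_pdivrMr//; apply: ub_le_sup; last by exists (x, y).
exists k => _ [[a b] /= ab <-].
by rewrite ler_pdivrMr ?mdist_gt0.
Qed.

(* When [dil f <= 0] the junk value [ln (dil f) = 0] is harmless, since
   [expR e] is positive. *)
Lemma dil_le_expR X Y (f : X -> Y) e : `|ln (dil f)| <= e -> dil f <= expR e.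
Proof.
move=> le; have [d0|d0] := leP (dil f) 0.
  exact: (le_trans d0 (expR_ge0 _)).
by rewrite -[leLHS]lnK ?posrE// ler_expR (le_trans (ler_norm _)).
Qed.

(** Both logarithms have nonnegative absolute value, so a bound on the sum bounds each, and one
    constant serves both directions. *)
Lemma lip_dist_lt_bilipschitz X Y e :
  (lip_dist X Y < e%:E)%E -> bilipschitz X Y (expR e).
Proof.
move=> /ereal_inf_lt[_ [d [d0 [f [g [fK gK fl gl fg]]]] <-]].
rewrite lte_fin => /ltW de; exists f, g; split => //.
- move=> x y; apply: le_trans (lipschitz_dil fl x y) _.
  rewrite ler_wpM2r ?mdist_ge0// dil_le_expR//.
  by rewrite (le_trans _ de)// (le_trans _ fg)// lerDl.
- move=> x y; apply: le_trans (lipschitz_dil gl x y) _.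
  rewrite ler_wpM2r ?mdist_ge0// dil_le_expR//.
  by rewrite (le_trans _ de)// (le_trans _ fg)// lerDr.
Qed.

Lemma lipschitz_continuous X Y k (f : X -> Y) :
  lipschitz_with k f -> continuous f.
Proof.
move=> fk x; apply/cvg_ballP => e e0.
have k0 : 0 < `|k| + 1 by rewrite ltr_wpDl.
apply/nbhs_ballP; exists (e / (`|k| + 1)) => /=; first by rewrite divr_gt0.
move=> y; rewrite !ballEmdist/= ltr_pdivlMr// => xy.
apply: le_lt_trans xy; apply: le_trans (fk _ _) _.
by rewrite mulrC ler_wpM2l ?mdist_ge0// (le_trans (ler_norm _))// lerDl.
Qed.

Lemma bilipschitz_compact X Y k : bilipschitz X Y k ->
  compact [set: X] -> compact [set: Y].
Proof.
move=> [f [g [fK gK fk gk]]] cX.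
have -> : [set: Y] = f @` [set: X].
  by apply/seteqP; split => // y _; exists (g y).
apply: continuous_compact => //.
exact/continuous_subspaceT/(lipschitz_continuous fk).
Qed.

End lipschitz_maps.

(** * The spaces [X_set t] and the rescaling bijections between them *)

Section spaces.
Context {R : realType}.
Implicit Types (t : nat -> bool) (n m : nat) (x y : R).

Definition width t n : R := 1 / 2 ^+ (if t n then n.+1 else n.+2).

(* [X_set (fun=> true)] is convertible to [X1_set R]. *)
Definition X_set t : set R :=
  [set 0] `|` \bigcup_(n in [set n : nat | (1 <= n)%N])
    `[1 / 2 ^+ n, 1 / 2 ^+ n + width t n]%classic.

Let u n : R := 1 / 2 ^+ n.

Lemma u_gt0 n : 0 < u n.
Proof. by rewrite divr_gt0// exprn_gt0. Qed.

Lemma uS n : u n.+1 = u n / 2.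
Proof. by rewrite /u exprSr !div1r invfM. Qed.

Lemma u_le n m : (n < m)%N -> u m <= u n / 2.
Proof.
move=> nm; rewrite -uS /u !div1r lef_pV2 ?posrE ?exprn_gt0//.
by rewrite ler_eXn2l// ltr1n.
Qed.

Lemma widthE t n : width t n = u n / (if t n then 2 else 4).
Proof.
rewrite /width; case: (t n); rewrite -/(u _) !uS//.
by field.
Qed.

Definition piece t n x := u n <= x <= u n + width t n.

Lemma piece_bounds t n x : piece t n x -> u n <= x <= 3 / 2 * u n.
Proof.
move=> /andP[ux]; rewrite ux widthE/=; have := u_gt0 n.
by case: (t n) => u0 xu; lra.
Qed.

Lemma X_setP t x :
  X_set t x <-> x = 0 \/ exists2 n, (1 <= n)%N & piece t n x.
Proof.
split=> [[->|[n n1 /=]]|[->|[n n1 xn]]]; [by left| |by left|].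
- by rewrite in_itv/= => xn; right; exists n.
- by right; exists n => //=; rewrite in_itv.
Qed.

Lemma X_set_ge0 t x : X_set t x -> 0 <= x.
Proof.
move=> /X_setP[->//|[n _ /andP[ux _]]].
exact: le_trans (ltW (u_gt0 n)) ux.
Qed.

(** Later pieces end by 3/4 of [u n] and earlier ones start at 2 [u n] or beyond. An approximate
    position thus identifies the piece. *)
Lemma pieceW t n x : (1 <= n)%N -> X_set t x ->
  3 / 4 * u n < x < 2 * u n -> piece t n x.
Proof.
move=> n1 /X_setP[->|[m m1 xm]] /andP[lx xu].
  by have := u_gt0 n; lra.
have /andP[ux xu'] := piece_bounds xm.
have [mn|nm|<-//] := ltngtP m n.
- by have := u_le mn; lra.
- by have := u_le nm; lra.
Qed.

Lemma piece_separated t n m x y : (n < m)%N -> piece t n x -> piece t m y ->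
  y <= 3 / 4 * x.
Proof.
move=> /u_le nm /piece_bounds/andP[? ?] /piece_bounds/andP[? ?]; lra.
Qed.

(* The graph of the piecewise affine bijection [X_set t -> X_set t']: for a
   relation, the Lipschitz bound already contains functionality, and symmetry
   gives the inverse. *)
Definition rescale t t' x y := (x = 0 /\ y = 0) \/
  exists n s, [/\ (1 <= n)%N, 0 <= s <= 1,
    x = u n + s * width t n & y = u n + s * width t' n].

Lemma rescale_sym t t' x y : rescale t t' x y -> rescale t' t y x.
Proof.
move=> [[-> ->]|[n [s [n1 s01 xs ys]]]]; first by left.
by right; exists n, s.
Qed.

Lemma width_gt0 t n : 0 < width t n.
Proof. by rewrite widthE divr_gt0 ?u_gt0//; case: (t n). Qed.

Lemma piece_rescale t n s : 0 <= s <= 1 -> piece t n (u n + s * width t n).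
Proof.
have := width_gt0 t n => w0 /andP[s0 s1]; rewrite /piece.
by rewrite lerDl mulr_ge0 ?(ltW w0)//= lerD2l ger_pMl.
Qed.

Lemma rescale_codom t t' x y : rescale t t' x y -> X_set t' y.
Proof.
move=> [[_ ->]|[n [s [n1 s01 _ ->]]]]; apply/X_setP; first by left.
by right; exists n => //; exact: piece_rescale.
Qed.

Lemma rescale_total t t' x : X_set t x -> exists y, rescale t t' x y.
Proof.
move=> /X_setP[->|[n n1 /andP[ux xu]]]; first by exists 0; left.
have w0 := width_gt0 t n; pose s := (x - u n) / width t n.
exists (u n + s * width t' n); right; exists n, s; split => //.
  by rewrite divr_ge0 ?subr_ge0 ?(ltW w0)//= ler_pdivrMr// mul1r lerBlDl.
by rewrite divfK ?gt_eqF// addrC subrK.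
Qed.

Lemma width_le t t' n : width t' n <= 2 * width t n.
Proof. by rewrite !widthE; have := u_gt0 n; case: (t n); case: (t' n); lra. Qed.

(** On a single piece the slope is at most 2. Otherwise the distance of the two points is at least
    1/4 of the larger one, and rescaling enlarges a point by a factor of at most 3/2, whence 6 = 4 *
    3/2. *)
Lemma rescale_lipschitz t t' x y x' y' : rescale t t' x y ->
  rescale t t' x' y' -> `|y - y'| <= 6 * `|x - x'|.
Proof.
have near0 n (s : R) : 0 <= s <= 1 ->
    u n + s * width t' n <= 3 / 2 * (u n + s * width t n).
  move=> s01; have /andP[_ h] := piece_bounds (piece_rescale t' n s01).
  have /andP[h' _] := piece_bounds (piece_rescale t n s01).
  by apply: le_trans h _; rewrite ler_wpM2l//; lra.
have pos t0 n (s : R) : 0 <= s <= 1 -> 0 <= u n + s * width t0 n.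
  move=> /piece_rescale -/(_ t0 n)/andP[+ _].
  exact/le_trans/ltW/u_gt0.
have far (a b a' b' : R) : 0 <= a -> 0 <= b' ->
    b <= 3 / 2 * a -> a' <= 3 / 4 * a -> b' <= b ->
    `|b - b'| <= 6 * `|a - a'|.
  move=> a0 b'0 ba a'a b'b; rewrite !ger0_norm ?subr_ge0//; lra.
move=> [[-> ->]|[n [s [n1 s01 -> ->]]]] [[-> ->]|[m [r [m1 r01 -> ->]]]].
- by rewrite subrr normr0 mulr0.
- rewrite distrC [in leRHS]distrC; apply: far => //; rewrite ?pos ?near0 //.
  by rewrite mulr_ge0 ?pos.
- by apply: far => //; rewrite ?pos ?near0 // mulr_ge0 ?pos.
have [nm|mn|<-] := ltngtP n m.
- apply: far; rewrite ?pos ?near0//.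
    by apply: (piece_separated nm); apply: piece_rescale.
  have := piece_separated nm (piece_rescale t' n s01) (piece_rescale t' m r01).
  by have := pos t' n s s01; lra.
- rewrite distrC [in leRHS]distrC; apply: far; rewrite ?pos ?near0//.
    by apply: (piece_separated mn); apply: piece_rescale.
  have := piece_separated mn (piece_rescale t' m r01) (piece_rescale t' n s01).
  by have := pos t' m r r01; lra.
- have diff w : u n + s * w - (u n + r * w) = (s - r) * w by ring.
  rewrite !diff; move: (width_le t t' n) (width_gt0 t n) (width_gt0 t' n).
  move: (width t n) (width t' n) => w w' ww' w0 w'0.
  rewrite !normrM mulrCA ler_wpM2l// !gtr0_norm//; lra.
Qed.

Lemma X_set_bilipschitz t t' :
  bilipschitz (X_set t : metricType R) (X_set t' : metricType R) 6.
Proof.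
have ex t0 t1 (x : X_set t0) :
    exists y : X_set t1, rescale t0 t1 (\val x) (\val y).
  have [y xy] := rescale_total t1 (set_valP x).
  by exists (exist _ y (mem_set (rescale_codom xy))).
have [f fP] := boolp.choice (ex t t').
have [g gP] := boolp.choice (ex t' t).
have uniq t0 t1 x y y' : rescale t0 t1 x y -> rescale t0 t1 x y' -> y = y'.
  move=> /rescale_lipschitz h /h; rewrite subrr normr0 mulr0 normr_le0.
  by move=> /eqP/subr0_eq.
exists f, g; split.
- move=> x; apply: val_inj; apply: uniq (gP _) _; exact/rescale_sym/fP.
- move=> x; apply: val_inj; apply: uniq (fP _) _; exact/rescale_sym/gP.
- by move=> x y; exact: rescale_lipschitz (fP _) (fP _).
- by move=> x y; exact: rescale_lipschitz (gP _) (gP _).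
Qed.

Lemma X_set_compact t : compact [set: X_set t].
Proof.
apply: (bilipschitz_compact (X_set_bilipschitz (fun=> true) t)).
exact: subspace_compact (@X1_set_compact R).
Qed.

Lemma piece_left t n : piece t n (u n).
Proof. by rewrite /piece lexx lerDl ltW ?width_gt0. Qed.

Lemma piece_right t n : piece t n (u n + width t n).
Proof. by rewrite /piece lexx lerDl ltW ?width_gt0. Qed.

Lemma piece_X_set t n x : (1 <= n)%N -> piece t n x -> X_set t x.
Proof. by move=> n1 xn; apply/X_setP; right; exists n. Qed.

(** * Rigidity of bijections with constants close to 1 *)

Section rigidity.
Variables (t t' : nat -> bool) (k : R).
Hypotheses (k1 : 1 <= k) (k8 : k * k < 8 / 7).
Variables (f : X_set t -> X_set t') (g : X_set t' -> X_set t).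
Hypotheses (fK : cancel f g) (gK : cancel g f).
Hypothesis (fk : forall x y : X_set t,
  `|\val (f x) - \val (f y)| <= k * `|\val x - \val y|).
Hypothesis (gk : forall x y : X_set t',
  `|\val (g x) - \val (g y)| <= k * `|\val x - \val y|).

Let point t0 x (xt : X_set t0 x) : X_set t0 := exist _ x (mem_set xt).

Let k43 : k < 4 / 3.
Proof.
rewrite ltNge; apply/negP => h.
have : 0 <= (k - 4 / 3) * (k - 4 / 3) by rewrite mulr_ge0// subr_ge0.
by move: k8; nra.
Qed.

(* If [f] sent [0] inside a piece, then for large [n] so would it send [u n],
   and the point at 7/8 of the way from [f 0] to [f (u n)] would come from a
   point in the gap below [u n]. *)
Lemma rigid_zero (o : X_set t) : \val o = 0 -> \val (f o) = 0.
Proof.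
move=> o0; have /X_setP[//|[m m1 pm]] := set_valP (f o).
(* With [u n] equal to [u m] / 8, the image of [u n] lies within [u m] / 4 of [f o], which keeps it
   in the window of [pieceW] for [m]. *)
pose n := m.+3; have um0 := u_gt0 m; have un0 := u_gt0 n.
have un : u n = u m / 8 by rewrite /n !uS; field.
have n1 : (1 <= n)%N by [].
pose a := point (piece_X_set n1 (piece_left t n)).
have /andP[p1 p2] := piece_bounds pm.
have := fk a o; rewrite o0 subr0 [\val a]/= (gtr0_norm un0) => qp.
have /ler_normlP[qp1 qp2] := qp.
have kun : k * u n < u m / 4 by rewrite un; move: k43; nra.
have qm : piece t' m (\val (f a)).
  apply: pieceW => //; first exact: set_valP.
  by apply/andP; split; lra.
set p := \val (f o) in pm p1 p2 qp qp1 qp2 *.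
set q := \val (f a) in qm qp qp1 qp2 *.
pose z := p + 7 / 8 * (q - p).
have zm : piece t' m z.
  move: pm qm => /andP[? ?] /andP[? ?].
  by apply/andP; split; rewrite /z; lra.
pose b := g (point (piece_X_set m1 zm)).
have fb : \val (f b) = z by rewrite /b gK.
have b0 : 0 <= \val b by exact: X_set_ge0 (set_valP b).
have zp : `|z - p| = 7 / 8 * `|q - p|.
  by rewrite /z addrAC subrr add0r normrM ger0_norm//; lra.
have := gk (f b) (f o); rewrite !fK o0 subr0 ger0_norm// fb -/p zp => bu.
have := fk b o; rewrite o0 subr0 (ger0_norm b0) fb -/p zp => bl.
have := gk (f a) (f o); rewrite !fK o0 subr0 [\val a]/= (gtr0_norm un0).
rewrite -/p -/q => al.
(* The distance of [b] to 0 is at most 7/8 [k * k * u n], where the bound 8/7 enters. It is at least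
   7/8 [u n] / ([k * k]), hence above 49/64 [u n], which exceeds 3/4 [u n]. *)
have b1 : \val b < u n by move: k1 k8; nra.
have b2 : 3 / 4 * u n < \val b by move: k1 k8; nra.
have /andP[] : piece t n (\val b).
  by apply: pieceW => //; [exact: set_valP|apply/andP; split; lra].
by rewrite leNgt b1.
Qed.

(** As 0 is fixed, [f] changes the distance to 0 by a factor of at most [k] < 4/3 either way, so a
    point between [u n] and 3/2 [u n] stays in the window of [pieceW]. *)
Lemma rigid_piece n (x : X_set t) :
  (1 <= n)%N -> piece t n (\val x) -> piece t' n (\val (f x)).
Proof.
move=> n1 xn; have /andP[x1 x2] := piece_bounds xn; have un0 := u_gt0 n.
have o0 : X_set t 0 by apply/X_setP; left.
pose o := point o0; have fo := @rigid_zero o erefl.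
have fx0 : 0 <= \val (f x) by exact: X_set_ge0 (set_valP _).
have := fk x o; have := gk (f x) (f o).
rewrite !fK fo [\val o]/= !subr0 !ger0_norm//; last by lra.
move=> h1 h2; apply: pieceW => //; first exact: set_valP.
by apply/andP; split; move: k1 k43; nra.
Qed.

(** The endpoints of the piece land in the [n]-th piece of [X_set t'], and [g] brings them back,
    stretching by at most [k]. *)
Lemma rigid_width n : (1 <= n)%N -> width t n <= k * width t' n.
Proof.
move=> n1.
pose a := point (piece_X_set n1 (piece_left t n)).
pose b := point (piece_X_set n1 (piece_right t n)).
have /andP[a1 a2] := @rigid_piece n a n1 (piece_left t n).
have /andP[b1 b2] := @rigid_piece n b n1 (piece_right t n).
have := gk (f b) (f a); rewrite !fK [\val b]/= [\val a]/=.
rewrite addrAC subrr add0r (gtr0_norm (width_gt0 t n)) => /le_trans; apply.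
rewrite ler_wpM2l//; first by move: k1; lra.
by apply/ler_normlP; split; lra.
Qed.

Lemma rigid_imply n : (1 <= n)%N -> t n -> t' n.
Proof.
move=> n1 tn; have := rigid_width n1; rewrite !widthE tn.
(* If [t' n] were false, the ratio of the widths would be 2, more than [k]. *)
by case: (t' n) => //; have := u_gt0 n; move: k43; nra.
Qed.

End rigidity.

Lemma X_set_rigid t t' (k : R) n : 1 <= k -> k * k < 8 / 7 ->
  bilipschitz (X_set t : metricType R) (X_set t' : metricType R) k ->
  (1 <= n)%N -> t n = t' n.
Proof.
move=> k1 k8 [f [g [fK gK fk gk]]] n1; apply/idP/idP.
- exact: (rigid_imply k1 k8 fK gK fk gk n1).
- exact: (rigid_imply k1 k8 gK fK gk fk n1).
Qed.

Definition X_space t : compactMetric R := CompactMetric (@X_set_compact t).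

Lemma M_X1_X_space t : M_X1 (isom_class (X_space t)).
Proof.
exists (X_space t) => //.
exact: bilipschitz_lip_dist_fin (X_set_bilipschitz t (fun=> true)).
Qed.

End spaces.

(** * Diagonal argument against a countable dense family *)

Theorem theorem1 (R : realType) :
  ~ separable_for (@lip_dist_class R) (@M_X1 R).
Proof.
move=> [D [[c cinj] DM Ddense]].
(* Passing through a dense point costs [expR e] twice, and [X_set_rigid] squares the result: the
   fourth power of 41/40 is below 8/7. *)
pose e : R := ln (41 / 40).
have e0 : 0 < e by rewrite ln_gt0//; lra.
have expe : expR e = 41 / 40 by rewrite lnK// posrE; lra.
pose code (t : nat -> bool) k := exists y,
  [/\ D y, c y = k & (lip_dist_class (isom_class (X_space t)) y < e%:E)%E].
have code_inj t t' k n : code t k -> code t' k -> (1 <= n)%N -> t n = t' n.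
  move=> [y [Dy <- ty]] [y' [Dy' yy' t'y]].
  have {Dy' yy'} yy' := cinj _ _ Dy' Dy yy'; subst y'.
  have [Y yY _] := DM _ Dy; subst y; move: ty t'y.
  rewrite !lip_dist_classE => /lip_dist_lt_bilipschitz tY.
  move=> /lip_dist_lt_bilipschitz/bilipschitz_sym Yt'.
  have := bilipschitz_trans (expR_ge0 e) (expR_ge0 e) tY Yt'.
  by rewrite expe; apply: X_set_rigid; lra.
(* Code [k] is contradicted at index [k.+1], because codes determine [t] only at indices from 1
   on. *)
pose diag n := ~~ `[< exists2 t, code t n.-1 & t n >].
have [y Dy yd] := Ddense _ (M_X1_X_space diag) e e0.
have dc : code diag (c y) by exists y.
have [dn|/negP dn] := boolP (diag (c y).+1).
- by move/negP: (dn); apply; apply/asboolP; exists diag.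
- have /negP/negPn/asboolP[t tc tn] := dn; apply: dn.
  by rewrite -(code_inj _ _ _ _ tc dc).
Qed.
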